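(* Any linear automorphism $\mathbf A$ of $L_{1,3}$ is a scalar multiple of a signed permutation that is induced by a vertex relabeling.
   Context: Index the coordinates of $\mathbb C^3$ by the edges $12,13,23$ of the triangle $K_3$. $M_{1,3}\subset\mathbb C^3$ is the set of vectors $((\mathbf p_i-\mathbf p_j)^2)_{ij}$ over all triples $(\mathbf p_1,\mathbf p_2,\mathbf p_3)\in\mathbb C^3$, and $L_{1,3}\subset\mathbb C^3$ is its preimage under the coordinate-wise squaring map. A linear automorphism of $L_{1,3}$ is a non-singular complex $3\times3$ matrix $\mathbf A$ with $\mathbf A(L_{1,3})=L_{1,3}$. A signed permutation is a matrix $\mathbf S\mathbf P$ with $\mathbf S$ diagonal with entries $\pm1$ and $\mathbf P$ a permutation matrix; it is induced by a vertex relabeling if $\mathbf P$ is the edge permutation induced by a permutation of the vertices $\{1,2,3\}$. *)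

(* Defs.v *)
From mathcomp Require Import all_boot all_order all_fingroup all_algebra.
From mathcomp Require Import complex.
From mathcomp Require Import boolp classical_sets reals.

Set Implicit Arguments.
Unset Strict Implicit.
Unset Printing Implicit Defensive.
Import GRing.Theory.
Local Open Scope classical_set_scope.
Local Open Scope ring_scope.

(* Vertices 1, 2, 3 are 0, 1, 2 : 'I_3; coordinates 0, 1, 2 of C^3 are the
   edges 12, 13, 23 respectively. *)
Definition edge_ends (e : 'I_3) : 'I_3 * 'I_3 :=
  tnth [tuple (inord 0, inord 1); (inord 0, inord 2); (inord 1, inord 2)] e.

Definition edge (e : 'I_3) : {set 'I_3} :=
  finset.setU (finset.set1 (edge_ends e).1) (finset.set1 (edge_ends e).2).

Definition edge_perm_induced (s t : 'S_3) : Prop :=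
  forall e, edge (t e) = imset s (mem (edge e)).

Section Measurement.
Variable R : realType.
Local Notation C := (R[i]).

Definition M13 : set 'cV[C]_3 :=
  [set m | exists p : 'I_3 -> C,
     m = \col_e (p (edge_ends e).1 - p (edge_ends e).2) ^+ 2].

Definition L13 : set 'cV[C]_3 := map_mx (fun z : C => z ^+ 2) @^-1` M13.

Definition linear_automorphism_L13 (A : 'M[C]_3) : Prop :=
  A \in unitmx /\ mulmx A @` L13 = L13.

Definition sign_mx (S : 'M[C]_3) : Prop :=
  is_diag_mx S /\ forall i, S i i = 1 \/ S i i = -1.

(* Since perm_mx t has its 1's at the entries (i, t i), the matrix sending the
   basis column of e to that of t e is perm_mx t^-1. *)
Definition vertex_relabeling_mx (P : 'M[C]_3) : Prop :=
  exists s t : 'S_3, edge_perm_induced s t /\ P = perm_mx (t^-1)%g.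

Definition relabeling_signed_perm_mx (B : 'M[C]_3) : Prop :=
  exists S P : 'M[C]_3,
    [/\ sign_mx S, vertex_relabeling_mx P & B = S *m P].

End Measurement.

(* Main.v *)
Require Import Defs.
From mathcomp Require Import all_boot all_order all_fingroup all_algebra.
From mathcomp Require Import complex.
From mathcomp Require Import boolp classical_sets reals.
From mathcomp Require Import ring.
Local Open Scope ring_scope.

Set Implicit Arguments.
Unset Strict Implicit.
Unset Printing Implicit Defensive.
Import GRing.Theory Num.Theory.

(** Write (x, y, z) for the coordinates on the edges 12, 13, 23.  The squared
    distances u, v, w between three points of a line satisfy
    u^2 + v^2 + w^2 = 2uv + 2uw + 2vw, and Heron's factorization
<<
    (x + y + z) (x - y - z) (- x + y - z) (- x - y + z)
      = x^4 + y^4 + z^4 - 2 x^2 y^2 - 2 x^2 z^2 - 2 y^2 z^2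
>>
    shows that L13 is the union of the four planes with normals
    v_0 = (1, 1, 1), v_1 = (1, -1, -1), v_2 = (-1, 1, -1), v_3 = (-1, -1, 1)
    ([L13_normal]).

    A linear automorphism A maps each plane into the union of the four, and
    since the field is infinite it maps it into a single one ([line_cover],
    [normal_pullback]).  So each row vector v_i A is a multiple of some v_j, with
    j = p i for a permutation p of the indices.  The only linear relations
    between the four normals are the multiples of v_0 + v_1 + v_2 + v_3 = 0
    ([normal_relation]), and A preserves this relation, so all the multipliers
    are one and the same scalar c ([normal_permutation]).

    Finally the sum of two distinct normals is plus or minus twice a basis
    vector ([normal_add]), and v_0 + v_(k+1) = 2 e_k.  Hence the rows e_k A are
    c times signed basis vectors, and A is c times a signed permutation
    ([signed_permutation]).  On a triangle each permutation of the edges is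
    induced by one of the vertices, because an edge is determined by the vertex
    opposite to it ([edge_perm_induced_exists]). *)

(** * Edge permutations of the triangle *)

(** The vertex opposite to the edge [e] is [rev_ord e]. *)
Lemma edgeE (e : 'I_3) : edge e = finset.setC (finset.set1 (rev_ord e)).
Proof.
apply/setP => x; rewrite /edge /edge_ends !inE !(tnth_nth (inord 0, inord 0)).
by case: e => [[|[|[|]]]] // ?; case: x => [[|[|[|]]]] // ?;
  rewrite /= -!val_eqE /= !inordK.
Qed.

(** Transport [t] to the vertices along edge |-> opposite vertex; a bijection of
    the vertices commutes with complements, so it acts on the edges as [t]. *)
Lemma edge_perm_induced_exists (t : 'S_3) : exists s, edge_perm_induced s t.
Proof.
have s_inj : injective (fun x : 'I_3 => rev_ord (t (rev_ord x))).
  by move=> x y /rev_ord_inj /perm_inj /rev_ord_inj.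
exists (perm s_inj) => e.
rewrite !edgeE; apply/setP => x; rewrite -[x](permKV (perm s_inj)).
set y := (_ x); rewrite mem_imset; last exact: perm_inj.
rewrite !inE permE (inj_eq rev_ord_inj) (inj_eq perm_inj).
by rewrite -(inj_eq rev_ord_inj) rev_ordK.
Qed.

(** * The four normals *)

(** Among more than #|I| points of the affine line a + t b, two are killed by the
    same [f i]; an affine function of t with two zeros is zero. *)
Lemma line_cover (F : numFieldType) (I : finType) n (f : I -> 'rV[F]_n)
    (a b : 'cV[F]_n) :
  (forall t : F, exists i, f i *m (a + t *: b) = 0) ->
  exists i, f i *m a = 0 /\ f i *m b = 0.
Proof.
move=> cov.
have [g gP] := fin_all_exists (fun k : 'I_#|I|.+1 => cov k%:R).
have /injectivePn [k [l neq_kl eq_g]] : ~~ injectiveb g.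
  by apply/negP => /injectiveP /leq_card; rewrite card_ord ltnn.
exists (g k).
have := gP l; have := gP k; rewrite -eq_g !mulmxDr -!scalemxAr => ak al.
have b0 : f (g k) *m b = 0.
  have /eqP : (k%:R - l%:R) *: (f (g k) *m b) = 0 :> 'M[F]_1.
    by rewrite scalerBl -(addrKA (f (g k) *m a)) ![_ + f _ *m a]addrC ak al subrr.
  rewrite scaler_eq0 subr_eq0 eqr_nat => /orP [/eqP /val_inj kl|/eqP //].
  by rewrite kl eqxx in neq_kl.
by move: ak; rewrite b0 scaler0 addr0.
Qed.

Section Normals.
Variable F : numFieldType.
Implicit Types (f : 'rV[F]_3) (x : 'cV[F]_3).

(** The vector v_0 is the all-ones vector, and v_(k+1) has its only positive entry
    at [k]; with these signs the four vectors add up to zero. *)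
Definition normal (i : 'I_4) : 'rV[F]_3 :=
  \row_k (if (i == 0 :> nat) || (i == k.+1 :> nat) then 1 else -1).

Lemma normal_sqr i k : normal i 0 k ^+ 2 = 1.
Proof. by rewrite mxE; case: ifP => _; rewrite ?sqrrN expr1n. Qed.

Lemma normal_mulE i x :
  (normal i *m x = 0) <-> (\sum_k normal i 0 k * x k 0 = 0).
Proof.
split=> [/matrixP /(_ 0 0)|h]; first by rewrite !mxE.
by apply/matrixP => p q; rewrite !ord1 !mxE.
Qed.

Lemma sum_normal : \sum_i normal i = 0.
Proof.
apply/rowP => k; rewrite summxE !big_ord_recl big_ord0 !mxE /=.
by case: k => [[|[|[|]]]] //= ?; ring.
Qed.

Lemma ord4_cases (P : 'I_4 -> Prop) :
  P ord0 -> P (lift ord0 ord0) -> P (lift ord0 (lift ord0 ord0)) ->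
  P (lift ord0 (lift ord0 (lift ord0 ord0))) -> forall i, P i.
Proof.
move=> P0 P1 P2 P3 i.
case: (unliftP ord0 i) => [j ->|-> //]; case: (unliftP ord0 j) => [k ->|-> //].
by case: (unliftP ord0 k) => [l ->|-> //]; rewrite (ord1 l).
Qed.

(** Two of the three coordinates of the relation have equal signs only at the
    indices 0 and i, so their sum is 2 mu_0 - 2 mu_i = 0. *)
Lemma normal_relation (mu : 'I_4 -> F) :
  \sum_i mu i *: normal i = 0 -> forall i, mu i = mu 0.
Proof.
move=> /rowP h; have := (h 0, h 1, h 2%:R).
rewrite !summxE !big_ord_recl !big_ord0 !mxE /= => -[[h0 h1] h2].
have half (u w a b : F) : a = 0 -> b = 0 -> u - w = (a + b) / 2 -> u = w.
  by move=> -> -> /eqP; rewrite addr0 mul0r subr_eq0 => /eqP.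
apply: ord4_cases => //; apply/esym.
- by apply: half h1 h2 _; field.
- by apply: half h0 h2 _; field.
- by apply: half h0 h1 _; field.
Qed.

(** These vectors span the plane orthogonal to [normal j], because the entries of
    a normal have square 1. *)
Definition plane_vector (j : 'I_4) (k l : 'I_3) : 'cV[F]_3 :=
  normal j 0 k *: delta_mx k 0 - normal j 0 l *: delta_mx l 0.

Lemma mulmx_plane_vector f j k l :
  (f *m plane_vector j k l) 0 0 = f 0 k * normal j 0 k - f 0 l * normal j 0 l.
Proof.
have entry (a : F) m : (f *m (a *: delta_mx m 0 : 'cV_3)) 0 0 = f 0 m * a.
  by rewrite -scalemxAr -colE mxE mxE mulrC.
by rewrite mulmxBr mxE [X in _ + X]mxE !entry.
Qed.

Lemma normal_plane_vector j k l : normal j *m plane_vector j k l = 0.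
Proof.
apply/matrixP => p q.
by rewrite !ord1 mulmx_plane_vector -!expr2 !normal_sqr subrr mxE.
Qed.

(** On the spanning vectors of the plane, the hypotheses say that f_k v_k does not
    depend on k; as v_k^2 = 1, the common value is the ratio of f to v. *)
Lemma vanish_on_plane j f :
  f *m plane_vector j 0 1 = 0 -> f *m plane_vector j 1 2%:R = 0 ->
  (f <= normal j)%MS.
Proof.
move=> /matrixP /(_ 0 0); rewrite mulmx_plane_vector [RHS]mxE => /subr0_eq f01.
move=> /matrixP /(_ 0 0); rewrite mulmx_plane_vector [RHS]mxE => /subr0_eq f12.
apply/sub_rVP; exists (f 0 0 * normal j 0 0); apply/rowP => k; rewrite mxE.
have -> : f 0 0 * normal j 0 0 = f 0 k * normal j 0 k.
  case: k => [[|[|[|]]]] // k3.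
  - by rewrite (_ : Ordinal k3 = 0) //; apply: val_inj.
  - by rewrite (_ : Ordinal k3 = 1) //; apply: val_inj.
  - by rewrite (_ : Ordinal k3 = 2%:R) ?f01 ?f12 //; apply: val_inj.
by rewrite -mulrA -expr2 normal_sqr mulr1.
Qed.

Lemma normal_agree_once i j : i != j ->
  exists m, forall k, (normal i 0 k == normal j 0 k) = (k == m).
Proof.
have eqs k : (normal i 0 k == normal j 0 k) =
    (((i == 0 :> nat) || (i == k.+1 :> nat)) ==
     ((j == 0 :> nat) || (j == k.+1 :> nat))).
  have m1 : (1 == -1 :> F) = false by rewrite eq_sym eqNr oner_eq0.
  by rewrite !mxE; do 2!case: ifP => _; rewrite ?eqxx // eq_sym.
(* Only the sign patterns matter, and those are compared by computation. *)
move=> neq_ij; suff [m mP] : exists m : 'I_3, forall k : 'I_3,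
    (((i == 0 :> nat) || (i == k.+1 :> nat)) ==
     ((j == 0 :> nat) || (j == k.+1 :> nat))) = (k == m).
  by exists m => k; rewrite eqs mP.
move: i j neq_ij {eqs}; apply: ord4_cases; apply: ord4_cases => // _;
  first [ by exists (@Ordinal 3 0 isT); case=> [[|[|[|]]]]
        | by exists (@Ordinal 3 1 isT); case=> [[|[|[|]]]]
        | by exists (@Ordinal 3 2 isT); case=> [[|[|[|]]]] ].
Qed.

(** The coordinates where two distinct normals differ cancel, and the single one
    where they agree doubles. *)
Lemma normal_add i j : i != j ->
  exists m (b : bool), normal i + normal j = (2 * (-1) ^+ b) *: delta_mx 0 m.
Proof.
move=> /normal_agree_once [m mP].
have sgn l k : normal l 0 k = 1 \/ normal l 0 k = -1.
  by rewrite mxE; case: ifP; [left|right].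
have [b jm] : exists b : bool, normal j 0 m = (-1) ^+ b.
  by have [->|->] := sgn j m; [exists false|exists true].
exists m, b; apply/rowP => k.
rewrite [LHS]mxE [RHS]mxE [delta_mx _ _ _ _]mxE eqxx /=.
have := mP k; case: (eqVneq k m) => [->|_] /eqP.
  by move=> ->; rewrite jm mulr1 mulr_natl.
by rewrite mulr0; have [->|->] := sgn i k; have [->|->] := sgn j k;
  rewrite ?eqxx // ?subrr ?addNr.
Qed.

(** If v_i = a v_j with i distinct from j, then (a + 1) v_j has exactly one nonzero
    entry by [normal_add], whereas all the entries of v_j are nonzero. *)
Lemma normal_line_inj i j : (normal i <= normal j)%MS -> i = j.
Proof.
move=> /sub_rVP [a ia]; apply/eqP; apply: contraT => /normal_add [m [b]].
rewrite {i}ia -{2}[normal j]scale1r -scalerDl => /rowP ijE.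
have {}ijE k : (a + 1) * normal j 0 k = 2 * (-1) ^+ b * (k == m)%:R.
  by have := ijE k; rewrite [LHS]mxE [RHS]mxE [delta_mx _ _ _ _]mxE eqxx.
have a1 : a + 1 = 0.
  have := ijE (lift m ord0); rewrite eq_sym (negPf (neq_lift _ _)) mulr0.
  move/(congr1 (fun z => z * normal j 0 (lift m ord0))).
  by rewrite -mulrA -expr2 normal_sqr mulr1 mul0r.
have := ijE m; rewrite a1 mul0r eqxx mulr1 => /esym/eqP.
by rewrite mulf_eq0 pnatr_eq0 signr_eq0.
Qed.
End Normals.

(** * Linear maps preserving the union of the planes *)

Section Automorphism.
Variables (F : numFieldType) (A : 'M[F]_3).
Local Notation v := (normal F).

(** The plane of [normal j] lies in the union of the kernels of the four forms
    [v i *m A], hence in one of these kernels. *)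
Lemma normal_pullback :
  (forall j (x : 'cV_3), v j *m x = 0 -> exists i, v i *m (A *m x) = 0) ->
  forall j, exists i, (v i *m A <= v j)%MS.
Proof.
move=> AL j.
have [i [ai bi]] : exists i, v i *m A *m plane_vector F j 0 1 = 0 /\
                             v i *m A *m plane_vector F j 1 2%:R = 0.
  apply: line_cover => t.
  have /AL [i iP] :
      v j *m (plane_vector F j 0 1 + t *: plane_vector F j 1 2%:R) = 0.
    by rewrite mulmxDr -scalemxAr !normal_plane_vector scaler0 addr0.
  by exists i; rewrite -mulmxA.
by exists i; apply: vanish_on_plane.
Qed.

Lemma normal_permutation :
  A \in unitmx ->
  (forall j (x : 'cV_3), v j *m x = 0 -> exists i, v i *m (A *m x) = 0) ->
  exists (c : F) (p : 'S_4), forall i, v i *m A = c *: v (p i).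
Proof.
move=> Au /normal_pullback /fin_all_exists [q qP].
have /fin_all_exists [mu muP] j : exists a, v (q j) *m A = a *: v j.
  exact/sub_rVP.
have q_inj : injective q.
  move=> j k qjk; have mu0 : mu k != 0.
    apply/eqP => mk; have := muP k; rewrite mk scale0r => /(canRL (mulmxK Au)).
    rewrite mul0mx => /rowP /(_ 0) /(congr1 (fun z => z ^+ 2)).
    by rewrite normal_sqr mxE expr0n => /eqP; rewrite oner_eq0.
  apply/esym/(@normal_line_inj F)/sub_rVP; exists ((mu k)^-1 * mu j).
  by rewrite -scalerA -muP qjk muP scalerA mulVf ?scale1r.
have muE : forall j, mu j = mu 0.
  apply: normal_relation; under eq_bigr do rewrite -muP.
  (* [A] turns the relation between the normals into one with coefficients
     [mu]. *)
  have := sum_normal F; rewrite (reindex_inj q_inj) -mulmx_suml => ->.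
  by rewrite mul0mx.
exists (mu 0), (perm q_inj)^-1%g => i.
by rewrite -(muE ((perm q_inj)^-1%g i)) -muP -(permE q_inj) permKV.
Qed.

Lemma signed_permutation (c : F) (p : 'S_4) :
  A \in unitmx -> (forall i, v i *m A = c *: v (p i)) ->
  exists (b : 'I_3 -> bool) (t : 'S_3),
    A = c *: (diag_mx (\row_k (-1) ^+ b k) *m perm_mx t).
Proof.
move=> Au pP.
have /fin_all_exists [t /fin_all_exists [b rowA]] (k : 'I_3) :
    exists m, exists b : bool, row k A = (c * (-1) ^+ b) *: delta_mx 0 m.
  have ek : v ord0 + v (lift ord0 k) = 2 *: delta_mx 0 k.
    apply/rowP => l; rewrite !mxE /= eqSS val_eqE [k == l]eq_sym.
    by case: eqVneq => _; rewrite ?mulr1 ?mulr0 ?subrr.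
  have [m [b pk]] : exists m (b : bool), v (p ord0) + v (p (lift ord0 k)) =
      (2 * (-1) ^+ b) *: delta_mx 0 m.
    by apply: normal_add; rewrite (inj_eq perm_inj) neq_lift.
  exists m, b; have /scalerI : (2 : F) != 0 by rewrite pnatr_eq0.
  apply; rewrite rowE scalemxAl -ek mulmxDl !pP -scalerDr pk !scalerA.
  by congr (_ *: _); ring.
(* Rows of [A] along the same basis vector would be equal or opposite. *)
have t_inj : injective t.
  move=> k l tkl; pose u : 'rV[F]_3 :=
    (-1) ^+ b k *: delta_mx 0 k - (-1) ^+ b l *: delta_mx 0 l.
  have : u *m A = 0.
    rewrite mulmxBl -!scalemxAl -!rowE !rowA tkl !scalerA.
    by rewrite ![_ * (c * _)]mulrCA -!expr2 !sqrr_sign subrr.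
  move/(canRL (mulmxK Au)); rewrite mul0mx => /rowP /(_ k).
  rewrite !mxE !eqxx /= mulr1; case: eqVneq => // _ /eqP.
  by rewrite mulr0 subr0 signr_eq0.
exists b, (perm t_inj).
apply/row_matrixP => k; rewrite rowA linearZ /=.
rewrite [in RHS]rowE mulmxA -rowE row_diag_mx.
rewrite -scalemxAl -rowE mxE scalerA; congr (_ *: _).
by apply/rowP => l; rewrite !mxE permE eqxx eq_sym.
Qed.
End Automorphism.

(** * The variety L13 as a union of planes *)

Section Planes.
Variable R : realType.
Local Notation C := (R[i]).

(** Heron's factorization puts L13 inside the union.  Conversely, on the plane with
    normal v the signed lengths y_k = v_k x_k sum to zero, so they are, up to sign,
    the differences of the points 0, - y_0, y_1. *)
Lemma L13_normal (x : 'cV[C]_3) : L13 x <-> exists i, normal C i *m x = 0.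
Proof.
split=> [[p xE]|[i /normal_mulE ix]].
  have sq k : x k 0 ^+ 2 = (p (edge_ends k).1 - p (edge_ends k).2) ^+ 2.
    by move/matrixP/(_ k 0): xE; rewrite !mxE.
  have /eqP : \prod_i \sum_k normal C i 0 k * x k 0 = 0.
    have := (sq 0, sq 1, sq 2%:R).
    rewrite /edge_ends !(tnth_nth (inord 0, inord 0)) /= => -[[s0 s1] s2].
    rewrite !big_ord_recl !big_ord0 !mxE /=.
    (* This quartic is a polynomial in the squares of the coordinates. *)
    transitivity (x 0 0 ^+ 4 + x 1 0 ^+ 4 + x 2%:R 0 ^+ 4
      - 2 * (x 0 0 * x 1 0) ^+ 2 - 2 * (x 0 0 * x 2%:R 0) ^+ 2
      - 2 * (x 1 0 * x 2%:R 0) ^+ 2).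
      have -> : lift ord0 ord0 = 1 :> 'I_3 by apply: val_inj.
      have -> : lift ord0 (lift ord0 ord0) = 2%:R :> 'I_3 by apply: val_inj.
      ring.
    by rewrite !exprMn !(exprM _ 2 2) s0 s1 s2; ring.
  move=> /prodf_eq0 [i _ /eqP ix]; exists i; exact/normal_mulE.
pose y k := normal C i 0 k * x k 0.
have y2 k : x k 0 ^+ 2 = y k ^+ 2 by rewrite exprMn normal_sqr mul1r.
have {}ix : y 0 + y 1 + y 2%:R = 0.
  rewrite -[RHS]ix !big_ord_recl big_ord0 addr0 addrA.
  by congr (_ + y _ + y _); apply: val_inj.
exists (fun v : 'I_3 => tnth [tuple 0; - y 0; y 1] v).
apply/colP => k; rewrite !mxE y2 /edge_ends (tnth_nth (inord 0, inord 0)).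
case: k => [[|[|[|]]]] //= k3; rewrite !(tnth_nth 0) !inordK //=.
- by rewrite (_ : Ordinal k3 = 0); [ring | apply: val_inj].
- by rewrite (_ : Ordinal k3 = 1); [ring | apply: val_inj].
- rewrite (_ : Ordinal k3 = 2%:R); last exact: val_inj.
  by rewrite -[y 2%:R](addrK (y 0 + y 1)) [y 2%:R + _]addrC ix; ring.
Qed.
End Planes.

(** * Linear automorphisms *)

Theorem theorem6p29 (R : realType) (A : 'M[R[i]]_3) :
  linear_automorphism_L13 A ->
  exists (c : R[i]) (B : 'M[R[i]]_3),
    relabeling_signed_perm_mx B /\ A = c *: B.
Proof.
move=> [Au AL].
have planeP j (x : 'cV_3) :
    normal _ j *m x = 0 -> exists i, normal _ i *m (A *m x) = 0.
  move=> jx; apply/L13_normal; rewrite -AL; exists x => //.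
  by apply/L13_normal; exists j.
have [c [p /(signed_permutation Au) [b [t AE]]]] :=
  normal_permutation Au planeP.
exists c, (diag_mx (\row_k (-1) ^+ b k) *m perm_mx t); split=> //.
have [s st] := edge_perm_induced_exists t^-1%g.
exists (diag_mx (\row_k (-1) ^+ b k)), (perm_mx t); split => //.
- split=> [|k]; first exact: diag_mx_is_diag.
  by rewrite !mxE eqxx; case: (b k); [right|left].
- by exists s, t^-1%g; rewrite invgK.
Qed.
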